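(* For positive integers $r,m$ let $M_{r,m}$ be the monogenic semigroup of index $r$ and period $m$ (so $|M_{r,m}|=r+m-1$). The automorphism groups of the superextensions $\lambda(M_{r,m})$ of all monogenic semigroups of cardinality at most $5$ are, up to isomorphism, as follows. Cardinality $1$: $\mathrm{Aut}(\lambda(M_{1,1}))\cong C_1$. Cardinality $2$: $\mathrm{Aut}(\lambda(M_{1,2}))\cong C_1$ and $\mathrm{Aut}(\lambda(M_{2,1}))\cong C_1$. Cardinality $3$: $\mathrm{Aut}(\lambda(M_{1,3}))\cong C_2$, $\mathrm{Aut}(\lambda(M_{2,2}))\cong C_2$, and $\mathrm{Aut}(\lambda(M_{3,1}))\cong C_1$. Cardinality $4$: $\mathrm{Aut}(\lambda(M_{1,4}))\cong C_2\times C_2$, $\mathrm{Aut}(\lambda(M_{2,3}))\cong S_3\times S_5$, $\mathrm{Aut}(\lambda(M_{3,2}))\cong S_3\times S_4$, and $\mathrm{Aut}(\lambda(M_{4,1}))\cong S_3\times S_4$. Cardinality $5$: $\mathrm{Aut}(\lambda(M_{1,5}))\cong C_4$, $\mathrm{Aut}(\lambda(M_{2,4}))\cong S_3^3\times S_8^3\times S_{17}\times S_{19}$, and each of $\mathrm{Aut}(\lambda(M_{3,3}))$, $\mathrm{Aut}(\lambda(M_{4,2}))$, $\mathrm{Aut}(\lambda(M_{5,1}))$ is isomorphic to $S_4^3\times S_5\times S_9^2\times S_{14}\times S_{18}$.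
   Context: $M_{r,m}=\{a,a^2,\dots,a^{r+m-1}\}$ denotes the finite monogenic semigroup with generator $a$, index $r$ and period $m$: the elements $a,\dots,a^{r+m-1}$ are pairwise distinct and $a^{r+m}=a^r$. $C_n$ is the cyclic group of order $n$, $S_n$ is the symmetric group on $n$ points, and $\mathrm{Aut}(X)$ is the group of automorphisms of a semigroup $X$. Superextension: a family $\mathcal A$ of non-empty subsets of a set $X$ is an upfamily if $A\in\mathcal A$ and $A\subset B\subset X$ imply $B\in\mathcal A$. An upfamily $\mathcal L$ is linked if $A\cap B\neq\emptyset$ for all $A,B\in\mathcal L$; it is maximal linked if it is linked and coincides with each linked upfamily on $X$ that contains it. $\lambda(X)$ denotes the set of all maximal linked upfamilies on $X$. For a semigroup $S$, $\lambda(S)$ is a semigroup under the operation $$\mathcal A*\mathcal B=\Big\{C\subset S:\ \exists A\in\mathcal A\ \exists (B_a)_{a\in A}\in\mathcal B^{A}\ \text{ with } \bigcup_{a\in A}aB_a\subset C\Big\},\qquad aB=\{ab:b\in B\}.$$ *)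

(* Defs.v *)
From mathcomp Require Import all_boot all_fingroup.

Set Implicit Arguments.
Unset Strict Implicit.
Unset Printing Implicit Defensive.

Local Open Scope group_scope.

Record finSemigroup := FinSemigroup {
  sg_sort :> finType;
  sg_mul : sg_sort -> sg_sort -> sg_sort;
  sg_mulA : associative sg_mul
}.

Local Notation "x ** y" := (sg_mul x y) (at level 40, left associativity).

(* The element i of 'I_(r + m).-1 stands for the power a^(i+1) of the         *)
(* generator a, so that the exponents run through 1, ..., r + m - 1.          *)
Definition expo n (x : 'I_n) : nat := x.+1.

(* The canonical exponent of a^k under the relation a^(r+m) = a^r. *)
Definition mred (r m k : nat) : nat :=
  if (k < r)%N then k else (r + (k - r) %% m)%N.

Fact mpow_subproof r m k : ((mred r.+1 m.+1 k).-1 < (r.+1 + m.+1).-1)%N.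
Proof.
rewrite addSn /= /mred; case: (ltnP k r.+1) => [lt_kr | le_rk].
  apply: leq_ltn_trans (leq_pred k) _; apply: leq_trans lt_kr _.
  by rewrite addnS ltnS leq_addr.
by rewrite addSn /= ltn_add2l ltn_pmod.
Qed.

(* The power a^k, for k > 0, in the monogenic semigroup of index r.+1 and     *)
(* period m.+1.                                                               *)
Definition mpow r m (k : nat) : 'I_(r.+1 + m.+1).-1 :=
  Ordinal (mpow_subproof r m k).

Definition mono_mul r m (x y : 'I_(r.+1 + m.+1).-1) : 'I_(r.+1 + m.+1).-1 :=
  mpow r m (expo x + expo y).

Lemma mredDl r m j k : mred r m (mred r m j + k) = mred r m (j + k).
Proof.
rewrite [mred r m j]/mred; case: ltnP => // le_rj.
rewrite -addnA /mred ltnNge leq_addr /= addKn ltnNge.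
by rewrite (leq_trans le_rj (leq_addr k j)) /= modnDml addnBAC.
Qed.

Lemma mredDr r m j k : mred r m (j + mred r m k) = mred r m (j + k).
Proof. by rewrite addnC mredDl addnC. Qed.

Lemma expo_mpow r m k : (0 < k)%N -> expo (mpow r m k) = mred r.+1 m.+1 k.
Proof.
by move=> k_gt0; rewrite /expo /= prednK // /mred; case: ifP; rewrite ?addSn.
Qed.

Lemma mono_mulA r m : associative (@mono_mul r m).
Proof.
move=> x y z; apply: val_inj => /=.
by rewrite !expo_mpow ?addSn // mredDl mredDr addnA.
Qed.

(* Meant for positive r and m; the value 0 is read as 1. *)
Definition monogenic (r m : nat) : finSemigroup :=
  FinSemigroup (@mono_mulA r.-1 m.-1).

Lemma card_monogenic r m : #|monogenic r.+1 m.+1| = (r.+1 + m.+1).-1.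
Proof. exact: card_ord. Qed.

Lemma mpowD r m j k : (0 < j)%N -> (0 < k)%N ->
  mpow r m (j + k) = sg_mul (f := monogenic r.+1 m.+1) (mpow r m j) (mpow r m k).
Proof.
move=> j_gt0 k_gt0; apply: val_inj => /=.
by rewrite !expo_mpow // mredDl mredDr.
Qed.

Lemma mpow_expo r m (x : monogenic r.+1 m.+1) : mpow r m (expo x) = x.
Proof.
apply: val_inj => /=; case: x => i lti /=.
rewrite /expo /mred /=; case: ltnP => //= le_ri.
by rewrite modn_small ?subnKC // ltn_subLR.
Qed.

Lemma mpow_period r m : mpow r m (r.+1 + m.+1) = mpow r m r.+1.
Proof.
apply: val_inj => /=.
by rewrite /mred ltnNge leq_addr /= addKn modnn ltnn subnn mod0n.
Qed.

Lemma mpow_inj r m j k : (0 < j < r.+1 + m.+1)%N -> (0 < k < r.+1 + m.+1)%N ->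
  mpow r m j = mpow r m k -> j = k.
Proof.
have redK i : (i < r.+1 + m.+1)%N -> mred r.+1 m.+1 i = i.
  rewrite /mred => lt_i; case: ltnP => // le_ri.
  by rewrite modn_small ?subnKC // ltn_subLR.
move=> /andP[j_gt0 /redK jK] /andP[k_gt0 /redK kK] /(congr1 (@expo _)).
by rewrite !expo_mpow // jK kK.
Qed.

Section Superextension.
Variable X : finType.
Implicit Types (F G : {set {set X}}) (A B C : {set X}).

Definition upfamily F : bool :=
  (set0 \notin F) && [forall A in F, forall B : {set X}, (A \subset B) ==> (B \in F)].

Definition linked F : bool :=
  [forall A in F, forall B in F, A :&: B != set0].

Definition max_linked F : bool :=
  maxset (fun G => upfamily G && linked G) F.

Definition max_linked_family : finType := {F : {set {set X}} | max_linked F}.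

Lemma upfamilyS F A B : upfamily F -> A \in F -> A \subset B -> B \in F.
Proof. by case/andP=> _ /forall_inP up /up/forallP/(_ B)/implyP. Qed.

Lemma linkedI F A B : linked F -> A \in F -> B \in F -> A :&: B != set0.
Proof. by move/forall_inP=> lF /lF/forall_inP; apply. Qed.

Lemma max_linked_upfamily F : max_linked F -> upfamily F.
Proof. by case/maxsetP=> /andP[]. Qed.

Lemma max_linkedC F A : (0 < #|X|)%N -> max_linked F ->
  (~: A \in F) = (A \notin F).
Proof.
move=> X_gt0 /maxsetP[/andP[upF lF] maxF].
have claim B : B != set0 -> ~: B \notin F -> B \in F.
  move=> nzB nFB; pose G := F :|: [set C : {set X} | B \subset C].
  suff <- : G = F by rewrite !inE subxx orbT.
  have FB (C D : {set X}) : C \in F -> B \subset D -> C :&: D != set0.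
    move=> FC sBD; apply: contraNneq nFB => CD0.
    apply: upfamilyS upF FC _; rewrite subsetC.
    by apply: subset_trans sBD _; rewrite -disjoints_subset -setI_eq0 setIC CD0.
  apply: maxF; last exact: subsetUl.
  apply/andP; split; first (apply/andP; split).
  - by case/andP: upF => nF0 _; rewrite !inE negb_or nF0 subset0.
  - apply/forall_inP=> C GC; apply/forallP=> D; apply/implyP=> sCD.
    move: GC; rewrite !inE => /orP[FC | sBC].
      by rewrite (upfamilyS upF FC sCD).
    by rewrite (subset_trans sBC sCD) orbT.
  - apply/forall_inP=> C GC; apply/forall_inP=> D; move: GC.
    rewrite !inE => /orP[FC | sBC] /orP[FD | sBD].
    + exact: linkedI lF FC FD.
    + exact: FB.
    + by rewrite setIC FB.
    + apply: contraNneq nzB => CD0; rewrite -subset0 -CD0.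
      by rewrite subsetI sBC.
have FT : setT \in F.
  apply: claim; first by rewrite -card_gt0 cardsT.
  by rewrite setCT; case/andP: upF.
apply/idP/idP => [FCA | nFA].
  by apply/negP=> FA; have := linkedI lF FA FCA; rewrite setICr eqxx.
have [-> | nzA] := eqVneq A set0; first by rewrite setC0.
by apply: contraNT nFA; exact: claim.
Qed.

Lemma max_linkedI F : upfamily F -> (forall A, (~: A \in F) = (A \notin F)) ->
  max_linked F.
Proof.
move=> upF FC; apply/maxsetP; split=> [|G /andP[upG lG] sFG].
  rewrite upF; apply/forall_inP=> A FA; apply/forall_inP=> B FB.
  apply: contraTneq FA => AB0; rewrite -FC; apply: upfamilyS upF FB _.
  by rewrite -disjoints_subset -setI_eq0 setIC AB0.
apply/eqP; rewrite eqEsubset sFG andbT; apply/subsetP=> A GA.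
apply: contraT; rewrite -FC => /(subsetP sFG) GCA.
by have := linkedI lG GA GCA; rewrite setICr eqxx.
Qed.

End Superextension.

Section SuperextensionSemigroup.
Variable S : finSemigroup.
Implicit Types (F G H : {set {set S}}) (A B C : {set S}).

(* Only the values of the family B on A matter. *)
Definition family_mul F G : {set {set S}} :=
  [set C : {set S} | [exists A in F, exists B : {ffun S -> {set S}},
     [forall a in A, B a \in G]
       && (\bigcup_(a in A) [set a ** b | b in B a] \subset C)]].

Lemma in_family_mul F G C : upfamily F -> upfamily G ->
  (C \in family_mul F G) = ([set a | [set b | a ** b \in C] \in G] \in F).
Proof.
move=> upF upG; rewrite inE; apply/exists_inP/idP.
  case=> A FA /existsP[B /andP[/forall_inP GB /bigcupsP sBC]].
  apply: upfamilyS upF FA _; apply/subsetP=> a Aa; rewrite inE.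
  apply: upfamilyS upG (GB a Aa) _; apply/subsetP=> b Bb; rewrite inE.
  by apply: (subsetP (sBC a Aa)); apply: imset_f.
move=> FA; exists [set a | [set b | a ** b \in C] \in G] => //.
apply/existsP; exists [ffun a => [set b | a ** b \in C]]; apply/andP; split.
  by apply/forall_inP=> a; rewrite ffunE inE.
apply/bigcupsP=> a _; apply/subsetP=> _ /imsetP[b + ->].
by rewrite ffunE inE.
Qed.

Lemma family_mul_upfamily F G :
  upfamily F -> upfamily G -> upfamily (family_mul F G).
Proof.
move=> upF upG; apply/andP; split.
  rewrite in_family_mul //.
  have -> : [set a | [set b | a ** b \in set0] \in G] = set0.
    apply/setP=> a; rewrite !inE.
    have -> : [set b | a ** b \in set0] = set0 by apply/setP=> b; rewrite !inE.
    by case/andP: upG => /negbTE.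
  by case/andP: upF.
apply/forall_inP=> A; rewrite inE => /exists_inP[D FD /existsP[B]].
case/andP=> GB sBA; apply/forallP=> C; apply/implyP=> sAC; rewrite inE.
apply/exists_inP; exists D => //; apply/existsP; exists B.
by rewrite GB (subset_trans sBA).
Qed.

Lemma family_mul_max_linked F G :
  max_linked F -> max_linked G -> max_linked (family_mul F G).
Proof.
move=> mF mG; have upF := max_linked_upfamily mF.
have upG := max_linked_upfamily mG.
have [S0 | S_gt0] := posnP #|S|.
  suff -> : family_mul F G = F by [].
  have no_fam H : upfamily H -> H = set0.
    case/andP=> nH0 _; apply/setP=> A; rewrite inE.
    have -> : A = set0 by apply/setP=> x; have := card0_eq S0 x.
    exact: negbTE.
  by rewrite (no_fam _ (family_mul_upfamily upF upG)) (no_fam _ upF).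
apply: max_linkedI => [|C]; first exact: family_mul_upfamily.
rewrite !in_family_mul // -max_linkedC //; congr (_ \in F).
apply/setP=> a; rewrite !inE -max_linkedC //; congr (_ \in G).
by apply/setP=> b; rewrite !inE.
Qed.

Definition superext_mul (F G : max_linked_family S) : max_linked_family S :=
  exist _ (family_mul (val F) (val G))
          (family_mul_max_linked (valP F) (valP G)).

Lemma superext_mulA : associative superext_mul.
Proof.
move=> [F mF] [G mG] [H mH]; apply: val_inj => /=; apply/setP=> C.
have [upF upG] := (max_linked_upfamily mF, max_linked_upfamily mG).
have upH := max_linked_upfamily mH.
rewrite !in_family_mul ?family_mul_upfamily //; congr (_ \in F).
apply/setP=> a; rewrite [LHS]inE [RHS]inE in_family_mul //; congr (_ \in G).
apply/setP=> b; rewrite !inE; congr (_ \in H).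
by apply/setP=> c; rewrite !inE sg_mulA.
Qed.

Definition superext : finSemigroup := FinSemigroup superext_mulA.

End SuperextensionSemigroup.

Section SemigroupAutomorphisms.
Variable S : finSemigroup.

Definition semigroupAut : {set {perm S}} :=
  [set f : {perm S} | [forall x, forall y, f (x ** y) == f x ** f y]].

Lemma semigroupAut_group_set : group_set semigroupAut.
Proof.
apply/group_setP; split=> [|f g].
  by rewrite inE; apply/forallP=> x; apply/forallP=> y; rewrite !perm1.
rewrite !inE => /forallP fM /forallP gM; apply/forallP=> x; apply/forallP=> y.
rewrite !permM; have /forallP/(_ y)/eqP-> := fM x.
exact: (forallP (gM (f x)) (f y)).
Qed.

Canonical semigroupAut_group := Group semigroupAut_group_set.

End SemigroupAutomorphisms.

(* Main.v *)
From Stdlib Require Import BinNat.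
From HB Require Import structures.
Require Import Defs.
From mathcomp Require Import all_boot all_fingroup all_algebra.
From mathcomp Require Import cyclic sylow.

Set Implicit Arguments.
Unset Strict Implicit.
Unset Printing Implicit Defensive.

(** The superextension of an n-element semigroup is a finite object: a maximal
linked family is the same thing as a monotone self-dual Boolean function of n
variables, and there are 1, 2, 4, 12, 81 of them for n = 1, ..., 5. The product
of families is C in F * G iff {a | {b | ab in C} in G} in F, a substitution of
Boolean functions. So a superextension is isomorphic to an explicit
multiplication table ([superext_index_perm], [superext_tableE]), on which the
automorphism group can be determined.

Automorphisms are controlled by colour refinement. Starting from a colouring of
the elements that an automorphism f preserves, colour x anew by the weights,
summed over all triples (y, z, yz) in which x occurs, where the weight of a
triple depends on the colours of its entries and on which of them coincide; f
preserves the new colouring too ([refine_preserves]).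

For index at least 2 there are few products: in cardinality 5, all products of
two families lie among 12 of the 81. Hence many elements are twins, with the
same row and the same column in the table. Refinement from the constant
colouring ends with classes consisting of twins and with every product alone in
its class. Then a permutation is an automorphism iff it preserves the colours
([twins_aut]), and the automorphism group is the direct product of the symmetric
groups of the colour classes ([twins_isog]).

For index 1 the semigroup is a cyclic group, and the bound comes from a base: a
tuple of elements such that refinement separates all elements once those of the
base have received colours of their own. An automorphism that fixes the base is
then trivial, so the order of the group is at most the product of the sizes of
the colour classes of the base points ([aut_card_le]). Explicit automorphisms
attain the bound: powers of the automorphism induced by a |-> a^2 on the
families over C_3 and C_5, and two commuting involutions over C_4, of which
only one comes from C_4 itself. The groups of order at most 2 for index at least
2 are obtained from a base as well. *)

(** * Boolean functions as decision trees *)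

(** A truth table in the form of a binary tree: branching on the first variable
first makes evaluation take n steps and keeps comparison of tables short. *)
Inductive tree (A : Type) := Leaf of A | Node of tree A & tree A.

(* Nested conditionals instead of && stop a strict evaluator at the first
   difference. *)
Fixpoint tree_eqb (t u : tree bool) : bool :=
  match t, u with
  | Leaf a, Leaf b => if a then b else ~~ b
  | Node l r, Node l' r' => if tree_eqb l l' then tree_eqb r r' else false
  | _, _ => false
  end.

Lemma tree_eqP : Equality.axiom tree_eqb.
Proof.
elim=> [a | l IHl r IHr] [b | l' r'] /=; try by constructor.
  by case: a b => [] []; constructor.
case: IHl => [<- | neq]; last by constructor=> -[].
by case: IHr => [<- | neq]; constructor=> // -[].
Qed.

HB.instance Definition _ := hasDecEq.Build (tree bool) tree_eqP.

Fixpoint lookup A (t : tree A) (s : bitseq) : A :=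
  match t, s with
  | Leaf a, _ => a
  | Node l r, b :: s' => if b then lookup r s' else lookup l s'
  | Node l _, [::] => lookup l [::]
  end.

Fixpoint tabulate A n (f : bitseq -> A) : tree A :=
  if n is n'.+1 then
    Node (tabulate n' (fun s => f (false :: s)))
         (tabulate n' (fun s => f (true :: s)))
  else Leaf (f [::]).

Fixpoint tree_map A B (f : A -> B) (t : tree A) : tree B :=
  match t with
  | Leaf a => Leaf (f a)
  | Node l r => Node (tree_map f l) (tree_map f r)
  end.

Lemma lookup_tabulate A n (f : bitseq -> A) s :
  size s = n -> lookup (tabulate n f) s = f s.
Proof.
elim: s n f => [|b s IHs] [|n] f //= [sz_s].
by case: b; rewrite IHs.
Qed.

Lemma eq_tabulate A n (f g : bitseq -> A) :
  (forall s, size s = n -> f s = g s) -> tabulate n f = tabulate n g.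
Proof.
elim: n f g => [|n IHn] f g eq_fg /=; first by rewrite eq_fg.
by congr Node; apply: IHn => s sz_s; rewrite eq_fg //= sz_s.
Qed.

Lemma tree_map_tabulate A B n (f : A -> B) (g : bitseq -> A) :
  tree_map f (tabulate n g) = tabulate n (f \o g).
Proof. by elim: n g => //= n IHn g; rewrite !IHn. Qed.

Fixpoint tree_le (t u : tree bool) : bool :=
  match t, u with
  | Leaf a, Leaf b => a ==> b
  | Node l r, Node l' r' => tree_le l l' && tree_le r r'
  | _, _ => false
  end.

Fixpoint dual (t : tree bool) : tree bool :=
  match t with
  | Leaf a => Leaf (~~ a)
  | Node l r => Node (dual r) (dual l)
  end.

Definition node_pair (p : tree bool * tree bool) := Node p.1 p.2.

Fixpoint monotones n : seq (tree bool) :=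
  if n is n'.+1 then
    let M := monotones n' in
    [seq node_pair p | p <- [seq (l, r) | l <- M, r <- M] & tree_le p.1 p.2]
  else [:: Leaf false; Leaf true].

(** All monotone self-dual functions of n + 1 variables. Self-duality determines
the restriction to the value 1 of the first variable as the dual of the
restriction t to the value 0, and monotonicity then says that t is monotone and
below its dual. *)
Definition families n : seq (tree bool) :=
  [seq Node t (dual t) | t <- monotones n & tree_le t (dual t)].

Lemma monotones_uniq n : uniq (monotones n).
Proof.
elim: n => //= n IHn; rewrite map_inj_uniq => [|[l r] [l' r'] [-> ->] //].
by rewrite filter_uniq // allpairs_uniq // => -[? ?] [].
Qed.

Lemma families_uniq n : uniq (families n).
Proof. by rewrite map_inj_uniq ?filter_uniq ?monotones_uniq // => t u []. Qed.

Definition pointwise_le (s t : bitseq) := all2 implb s t.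

Definition monotone_fun n (f : bitseq -> bool) :=
  forall s t, size s = n -> size t = n -> pointwise_le s t -> f s -> f t.

Lemma pointwise_le_refl s : pointwise_le s s.
Proof. by elim: s => //= b s ->; rewrite implybb. Qed.

Lemma tree_le_tabulate n (f g : bitseq -> bool) :
  reflect (forall s, size s = n -> f s -> g s)
          (tree_le (tabulate n f) (tabulate n g)).
Proof.
elim: n f g => [|n IHn] f g /=.
  by apply: (iffP implyP) => [fg [] // | ]; apply.
apply: (iffP andP) => [[/IHn le0 /IHn le1] [|[] s] //= [sz_s] | le_fg].
- exact: le1.
- exact: le0.
by split; apply/IHn => s sz_s; apply: le_fg; rewrite /= sz_s.
Qed.

Lemma dual_tabulate n (f : bitseq -> bool) :
  dual (tabulate n f) = tabulate n (fun s => ~~ f (map negb s)).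
Proof. by elim: n f => //= n IHn f; rewrite !IHn. Qed.

Lemma monotonesP n t :
  reflect (exists2 f, monotone_fun n f & t = tabulate n f) (t \in monotones n).
Proof.
elim: n t => [|n IHn] t /=.
  apply: (iffP idP) => [|[f _ ->]].
    rewrite !inE => /orP[] /eqP->.
      by exists xpred0.
    by exists xpredT.
  by rewrite !inE; case: (f _).
apply: (iffP mapP) => [[[l r]] | [f mf ->]].
  rewrite mem_filter => /andP[/= le_lr /allpairsP[[l' r'] /= [+ + [? ?]]]].
  subst l' r' => /IHn[f mf def_l] /IHn[g mg def_r] ->; subst l r.
  exists (fun s => if head false s then g (behead s) else f (behead s)).
    move=> [|b s] [|b' s'] //= [sz_s] [sz_s'] /andP[le_b le_s].
    case: b b' le_b => [] [] // _; [exact: mg | | exact: mf].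
    by move/(mf _ _ sz_s sz_s' le_s); apply: (tree_le_tabulate _ _ _ le_lr).
  by congr Node; apply: eq_tabulate.
exists (tabulate n (fun s => f (false :: s)), tabulate n (fun s => f (true :: s))) => //.
rewrite mem_filter /=; apply/andP; split.
  apply/tree_le_tabulate=> s sz_s; apply: mf; rewrite /= ?sz_s //.
  exact: pointwise_le_refl.
by apply: allpairs_f; apply/IHn; eexists; try reflexivity;
  move=> s s' sz_s sz_s' le_ss'; apply: mf; rewrite /= ?sz_s ?sz_s'.
Qed.

Lemma familiesP n t :
  reflect (exists2 f, monotone_fun n.+1 f &
             (forall s, size s = n.+1 -> f (map negb s) = ~~ f s) /\
             t = tabulate n.+1 f)
          (t \in families n).
Proof.
apply: (iffP mapP) => [[u] | [f mf [sdf ->]]].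
  rewrite mem_filter => /andP[le_u Mu ->{t}].
  have /monotonesP[g mg def_u] := Mu; subst u.
  pose f s := if head false s then ~~ g (map negb (behead s)) else g (behead s).
  have tab_f : Node (tabulate n g) (dual (tabulate n g)) = tabulate n.+1 f.
    by rewrite dual_tabulate.
  exists f; last split=> //.
    have /monotonesP[f' mf' eq_f] : tabulate n.+1 f \in monotones n.+1.
      rewrite -tab_f; apply/mapP; exists (tabulate n g, dual (tabulate n g)) => //.
      rewrite mem_filter le_u /= allpairs_f //; apply/monotonesP.
      rewrite dual_tabulate; eexists; last reflexivity.
      move=> s s' sz_s sz_s' le_ss'; apply: contra; apply: mg; rewrite ?size_map //.
      elim: s s' {sz_s sz_s'} le_ss' => [|b s IHs] [|b' s'] //= /andP[le_b /IHs->].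
      by case: b b' le_b => [] [].
    move=> s s' sz_s sz_s' le_ss'.
    rewrite -(lookup_tabulate f sz_s) -(lookup_tabulate f sz_s') eq_f.
    by rewrite !lookup_tabulate //; apply: mf'.
  move=> [|[] s] //= _; rewrite /f /= ?negbK //.
  by rewrite mapK //; apply: negbK.
have sdf1 s : size s = n -> f (true :: s) = ~~ f (false :: map negb s).
  move=> sz_s; rewrite -sdf /= ?size_map ?sz_s //.
  by rewrite (mapK negbK).
exists (tabulate n (fun s => f (false :: s))).
  rewrite mem_filter; apply/andP; split.
    rewrite dual_tabulate; apply/tree_le_tabulate=> s sz_s.
    rewrite -sdf1 //; apply: mf; rewrite /= ?sz_s //; exact: pointwise_le_refl.
  apply/monotonesP; eexists; last reflexivity.
  by move=> s s' sz_s sz_s' le_ss'; apply: mf; rewrite /= ?sz_s ?sz_s'.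
by rewrite dual_tabulate; congr Node; apply: eq_tabulate => s /sdf1.
Qed.

(** * Maximal linked families as Boolean functions *)

Section Code.
Variables (n' : nat).
Local Notation n := n'.+1.
Implicit Types (A : {set 'I_n}) (F : {set {set 'I_n}}).

Definition set_of (s : bitseq) : {set 'I_n} := [set i : 'I_n | nth false s i].
Definition bits A : bitseq := [seq i \in A | i <- enum 'I_n].

Lemma size_bits A : size (bits A) = n.
Proof. by rewrite size_map size_enum_ord. Qed.

Lemma nth_bits A (i : 'I_n) : nth false (bits A) i = (i \in A).
Proof. by rewrite (nth_map i) ?size_enum_ord // nth_ord_enum. Qed.

Lemma bitsK A : set_of (bits A) = A.
Proof. by apply/setP=> i; rewrite inE nth_bits. Qed.

Lemma set_ofK s : size s = n -> bits (set_of s) = s.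
Proof.
move=> sz_s; apply: (@eq_from_nth _ false); rewrite size_bits ?sz_s // => i lti.
by rewrite (nth_bits _ (Ordinal lti)) inE.
Qed.

Definition code F : tree bool := tabulate n (fun s => set_of s \in F).

Lemma lookup_code F A : lookup (code F) (bits A) = (A \in F).
Proof. by rewrite lookup_tabulate ?size_bits // bitsK. Qed.

Lemma lookup_code_set F s :
  size s = n -> lookup (code F) s = (set_of s \in F).
Proof. by move=> sz_s; rewrite lookup_tabulate. Qed.

Lemma code_inj : injective code.
Proof.
move=> F G eqFG; apply/setP=> A.
by rewrite -(lookup_code F) eqFG lookup_code.
Qed.

Lemma set_ofC s : size s = n -> set_of (map negb s) = ~: set_of s.
Proof.
by move=> sz_s; apply/setP=> i; rewrite !inE (nth_map false) // sz_s.
Qed.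

Lemma set_ofS s t : size s = n -> size t = n ->
  pointwise_le s t = (set_of s \subset set_of t).
Proof.
move=> sz_s sz_t.
have -> : pointwise_le s t = [forall i : 'I_n, nth false s i ==> nth false t i].
  rewrite /pointwise_le all2E sz_s sz_t eqxx /=; apply/allP/forallP => [le_st i | le_st].
    have := le_st (nth (false, false) (zip s t) i).
    rewrite nth_zip ?sz_s ?sz_t //=; apply.
    by rewrite -nth_zip ?sz_s ?sz_t // mem_nth // size_zip sz_s sz_t minnn.
  move=> p /(nthP (false, false))[i]; rewrite size_zip sz_s sz_t minnn => lti <-.
  by rewrite nth_zip ?sz_s ?sz_t //; apply: (le_st (Ordinal lti)).
apply/forallP/subsetP => [le_st i | le_st i]; last first.
  by apply/implyP => si; have := le_st i; rewrite !inE; apply.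
by rewrite !inE; apply/implyP.
Qed.

(** Self-duality of the truth table is the fact that a maximal linked family
contains exactly one of any two complementary sets. *)
Lemma code_families F : max_linked F -> code F \in families n'.
Proof.
move=> mF; have upF := max_linked_upfamily mF.
apply/familiesP; exists (fun s => set_of s \in F); last split=> // s sz_s.
  move=> s t sz_s sz_t; rewrite set_ofS // => sst Fs.
  exact: upfamilyS upF Fs sst.
by rewrite set_ofC // max_linkedC // card_ord.
Qed.

Lemma families_code t : t \in families n' -> exists2 F, max_linked F & code F = t.
Proof.
case/familiesP=> f mf [sdf ->{t}]; pose F : {set {set 'I_n}} := [set A | f (bits A)].
have FC A : (~: A \in F) = (A \notin F).
  rewrite !inE -sdf ?size_bits // -{1}(bitsK A) -set_ofC ?size_bits //.
  by rewrite set_ofK // size_map size_bits.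
have FS (A B : {set 'I_n}) : A \in F -> A \subset B -> B \in F.
  rewrite !inE -{2}(bitsK A) -{1}(bitsK B) -set_ofS ?size_bits // => fA sAB.
  by apply: mf sAB fA; rewrite size_bits.
exists F; last by apply: eq_tabulate => s sz_s; rewrite inE set_ofK.
apply: max_linkedI => //; apply/andP; split.
  by apply/negP=> F0; have := FS _ _ F0 (sub0set (~: set0)); rewrite FC F0.
by apply/forall_inP=> A FA; apply/forallP=> B; apply/implyP; apply: FS FA.
Qed.

End Code.

(** * The multiplication table of a superextension *)

(** The map C |-> {a | {b | ab in C} in G}, where u is the truth table of G and
[rows] is the multiplication table of the underlying semigroup. It does not
involve the left factor, so that it is computed once for a whole column. *)
Definition shifts n (rows : seq (seq nat)) (u : tree bool) : tree bitseq :=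
  tabulate n (fun s => [seq lookup u [seq nth false s k | k <- row] | row <- rows]).

Definition op_rows n (o : nat -> nat -> nat) : seq (seq nat) :=
  [seq [seq o i j | j <- iota 0 n] | i <- iota 0 n].

Definition superext_table n' (o : nat -> nat -> nat) : seq (seq nat) :=
  let E := families n' in
  let D := [seq shifts n'.+1 (op_rows n'.+1 o) u | u <- E] in
  [seq [seq index (tree_map (lookup t) d) E | d <- D] | t <- E].

Lemma map_index_self (A : eqType) (s : seq A) :
  uniq s -> [seq index x s | x <- s] = iota 0 (size s).
Proof.
move=> us; apply: (@eq_from_nth _ 0); rewrite size_map ?size_iota // => i lti.
have x0 : A by case: s lti {us} => //= x.
by rewrite (nth_map x0) // index_uniq // nth_iota.
Qed.

Section Table.
Variables (n' : nat) (op : 'I_n'.+1 -> 'I_n'.+1 -> 'I_n'.+1).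
Variables (opA : associative op) (o : nat -> nat -> nat).
Hypothesis opE : forall x y, op x y = o x y :> nat.
Local Notation n := n'.+1.
Local Notation S := (FinSemigroup opA).
Implicit Types F G : superext S.

Lemma code_mul F G :
  code (val (sg_mul F G)) =
    tree_map (lookup (code (val F))) (shifts n (op_rows n o) (code (val G))).
Proof.
case: F G => [F mF] [G mG].
rewrite tree_map_tabulate; apply: eq_tabulate => s sz_s.
rewrite -[LHS]/(set_of n' s \in @family_mul S F G).
rewrite -[RHS]/(lookup (code F) [seq lookup (code G)
  [seq nth false s k | k <- row] | row <- op_rows n o]).
rewrite (@in_family_mul S) ?max_linked_upfamily // lookup_code_set.
  congr (_ \in F); apply/setP=> a; rewrite !inE (nth_map [::]) ?size_map ?size_iota //.
  rewrite (nth_map 0) ?size_iota // nth_iota // lookup_code_set.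
    congr (_ \in G); apply/setP=> b; rewrite !inE opE.
    rewrite (nth_map 0) ?size_map ?size_iota //.
    by rewrite (nth_map 0) ?size_iota // nth_iota.
  by rewrite !size_map size_iota.
by rewrite !size_map size_iota.
Qed.

Definition superext_index F : nat := index (code (val F)) (families n').

Lemma superext_index_perm :
  perm_eq [seq superext_index F | F <- enum (superext S)]
          (iota 0 (size (families n'))).
Proof.
have code_enum : perm_eq [seq code (val F) | F <- enum (superext S)] (families n').
  apply: uniq_perm; rewrite ?families_uniq //.
    rewrite map_inj_uniq ?enum_uniq // => F G /code_inj; exact: val_inj.
  move=> t; apply/mapP/idP => [[F _ ->] | /families_code[F mF <-]].
    exact: code_families (valP F).
  by exists (exist _ F mF); rewrite ?mem_enum.
have -> : [seq superext_index F | F <- enum (superext S)] =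
    [seq index t (families n') | t <- [seq code (val F) | F <- enum (superext S)]].
  by rewrite -[RHS]map_comp.
by rewrite -(map_index_self (families_uniq n')) perm_map.
Qed.

Lemma superext_tableE F G :
  superext_index (sg_mul F G) =
    nth 0 (nth [::] (superext_table n' o) (superext_index F)) (superext_index G).
Proof.
have index_lt H : superext_index H < size (families n').
  by rewrite index_mem; apply: code_families (valP H).
have nth_index_code d H : nth d (families n') (superext_index H) = code (val H).
  by rewrite nth_index //; apply: code_families (valP H).
rewrite (nth_map (Leaf true)) // nth_index_code.
rewrite (nth_map (Leaf [::])); last by rewrite [size (map _ _)]size_map.
by rewrite (nth_map (Leaf true)) // nth_index_code -code_mul.
Qed.

End Table.

(** * Direct products of symmetric groups *)

(** The coercion that elaboration inserts around each canonical group structure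
is unfolded: with it, comparing these groups with explicitly written products
takes time exponential in the number of factors. *)
Definition sym_prod : nat -> seq nat -> finGroupType :=
  Eval unfold reverse_coercion in
  fix sym_prod n ns : finGroupType :=
    if ns is m :: ns' then (sym_prod m ns' * 'S_n)%type else 'S_n.

Section SymIsog.
Local Open Scope group_scope.
Variables (T : finType) (A : {set T}).

(** The isomorphism conjugates by an enumeration of A and extends by the
identity outside A. *)
Lemma Sym_isog : Sym A \isog [set: 'S_#|A|].
Proof.
have [A0 | [a0 Aa0]] := set_0Vmem A.
  apply: trivial_isog; apply/eqP; rewrite trivg_card1.
    by rewrite card_Sym A0 cards0.
  by rewrite cardsT card_Sn A0 cards0.
rewrite isog_sym; pose ext (s : 'S_#|A|) x :=
  if x \in A then enum_val (s (enum_rank_in Aa0 x)) else x.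
have extA s x : (ext s x \in A) = (x \in A).
  by rewrite /ext; case: (boolP (x \in A)) => Ax; rewrite ?enum_valP ?(negbTE Ax).
have extK s : cancel (ext s) (ext s^-1).
  move=> x; rewrite {1}/ext extA /ext; case: ifP => Ax; rewrite Ax //.
  by rewrite enum_valK_in permK enum_rankK_in.
pose h s := perm (can_inj (extK s)).
have hM : {in setT &, {morph h : s t / s * t}}.
  move=> s t _ _; apply/permP=> x; rewrite permM !permE.
  rewrite {2}/ext extA /ext; case: ifP => Ax; rewrite ?Ax //.
  by rewrite enum_valK_in permM.
have inj_h : 'injm (Morphism hM).
  apply/injmP=> s t _ _ /permP st; apply/permP=> i; apply: enum_val_inj.
  by have:= st (enum_val i); rewrite !permE /ext enum_valP enum_valK_in.
apply/isogP; exists (Morphism hM) => //=; apply/eqP.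
rewrite eqEcard card_injm // card_Sym cardsT card_Sn leqnn andbT.
apply/subsetP=> _ /morphimP[s _ _ ->]; rewrite inE.
by apply/subsetP=> x; rewrite inE permE /ext; case: ifP => // _; rewrite eqxx.
Qed.

End SymIsog.

Section Products.
Local Open Scope group_scope.

Lemma isog_setX (gT aT bT : finGroupType) (G A B : {group gT})
    (H : {group aT}) (K : {group bT}) :
  A \x B = G -> A \isog H -> B \isog K -> G \isog setX H K.
Proof.
move=> defG isoA isoB; apply: (isog_dprod defG (setX_dprod H K)).
  rewrite -morphim_pairg1; apply: isog_trans isoA _.
  by apply: sub_isog; rewrite ?subsetT ?injm_pairg1.
rewrite -morphim_pair1g; apply: isog_trans isoB _.
by apply: sub_isog; rewrite ?subsetT ?injm_pair1g.
Qed.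

Lemma setXTT (aT bT : finGroupType) :
  setX [set: aT] [set: bT] = [set: aT * bT].
Proof. by apply/setP=> x; rewrite !inE. Qed.

Lemma isog_Klein (gT : finGroupType) (G : {group gT}) f g :
  #|G| <= 4 -> f \in G -> g \in G -> #[f] = 2 -> #[g] = 2 -> f != g ->
  G \isog setX (Zp 2) (Zp 2).
Proof.
move=> leG4 fG gG of2 og2 neq_fg.
have nfg : f \notin <[g]>.
  rewrite (cycle2g og2) !inE negb_or neq_fg andbT.
  by apply: contra_eqN of2 => /eqP->; rewrite order1.
have tiFG : <[f]> :&: <[g]> = 1.
  by apply: prime_TIg; rewrite ?cycle_subG // -orderE of2.
have defG : <[f]> * <[g]> = G.
  apply/eqP; rewrite eqEcard mul_subG ?cycle_subG //=.
  by rewrite TI_cardMg // -!orderE of2 og2.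
have cGG : abelian G.
  by apply: (@card_p2group_abelian _ 2) => //; rewrite -defG TI_cardMg // -!orderE of2 og2.
have cFG : <[g]> \subset 'C(<[f]>).
  by apply: (sub_abelian_cent2 cGG); rewrite cycle_subG.
have isoZ h : #[h] = 2 -> <[h]> \isog Zp 2.
  by move=> oh; have := Zp_isog h; rewrite oh isog_sym.
by apply: (@isog_setX _ _ _ _ <[f]> <[g]>); rewrite ?isoZ // dprodE.
Qed.

Lemma isog_Zp (gT : finGroupType) (G : {group gT}) f n :
  0 < n -> #|G| <= n -> f \in G -> (forall i, 0 < i < n -> f ^+ i != 1) ->
  G \isog Zp n.
Proof.
move=> n_gt0 leGn fG f_neq1.
have le_nf : n <= #[f].
  rewrite leqNgt; apply/negP=> ltfn.
  by have := f_neq1 #[f]; rewrite order_gt0 ltfn expg_order eqxx => /(_ isT).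
have le_fG : #[f] <= #|G| by apply: dvdn_leq (order_dvdG fG).
have ofn : #[f] = n by apply/eqP; rewrite eqn_leq le_nf (leq_trans le_fG).
have -> : G :=: <[f]>.
  by apply/esym/eqP; rewrite eqEcard cycle_subG fG -orderE ofn.
by have := Zp_isog f; rewrite ofn isog_sym.
Qed.

End Products.

Section ColourPerm.
Local Open Scope group_scope.
Variables (T : finType) (C : eqType) (c : T -> C).
Implicit Types (ks : seq C) (f g : {perm T}).

(** The permutations that preserve the colouring c and move only points whose
colour is in ks. Growing ks one colour at a time splits off one symmetric group
at a time. *)
Definition colour_sym ks : {set {perm T}} :=
  [set f : {perm T} | [forall x, (c (f x) == c x) && ((c x \in ks) || (f x == x))]].

Lemma colour_symP ks f :
  reflect (forall x, c (f x) = c x /\ (c x \notin ks -> f x = x))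
          (f \in colour_sym ks).
Proof.
rewrite inE; apply: (iffP forallP) => [fP x | fP x].
  by have /andP[/eqP-> /orP[-> // | /eqP->]] := fP x.
by have [-> fixf] := fP x; rewrite eqxx; case: (boolP (_ \in _)) => //= /fixf->.
Qed.

Lemma colour_sym_group_set ks : group_set (colour_sym ks).
Proof.
apply/group_setP; split=> [|f g /colour_symP fP /colour_symP gP].
  by apply/colour_symP=> x; rewrite perm1.
apply/colour_symP=> x; rewrite permM; have [fc ff] := fP x.
have [gc gf] := gP (f x); rewrite gc fc; split=> // nx.
by rewrite gf ?fc ?ff.
Qed.
Canonical colour_sym_group ks := Group (colour_sym_group_set ks).

Definition colour_class k : {set T} := [set x | c x == k].

(** A colour-preserving permutation maps the class of k to itself; its
restriction to that class and what remains of it are the two components. *)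
Lemma colour_sym_cons k ks : k \notin ks ->
  Sym (colour_class k) \x colour_sym ks = colour_sym (k :: ks).
Proof.
move=> nks; set A := colour_class k.
have SymP f : f \in Sym A -> forall x, c x != k -> f x = x.
  by rewrite inE => fA x nx; apply: out_perm fA _; rewrite inE.
have SymA f : f \in Sym A -> forall x, c (f x) = c x.
  move=> fA x; have [xk | /(SymP f fA) -> //] := eqVneq (c x) k.
  by move: fA; rewrite inE => /(perm_closed x); rewrite !inE xk eqxx => /eqP.
have ksP f x : f \in colour_sym ks -> c x = k -> f x = x.
  by move=> /colour_symP/(_ x)[_ fixf] xk; apply: fixf; rewrite xk.
rewrite dprodE; first 1 last.
- apply/centsP=> f fP g gA; apply/permP=> x; rewrite !permM.
  have [xk | nxk] := eqVneq (c x) k.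
    by rewrite (ksP f (g x)) ?(ksP f x) ?SymA.
  by rewrite (SymP g gA x nxk) (SymP g gA) // (colour_symP _ _ fP x).1.
- apply/trivgP; apply/subsetP=> f /setIP[fA fP]; rewrite inE; apply/eqP/permP=> x.
  rewrite perm1; have [xk | nxk] := eqVneq (c x) k; first exact: ksP.
  exact: SymP nxk.
apply/eqP; rewrite eqEsubset; apply/andP; split.
  apply/subsetP=> _ /mulsgP[f g fA gP ->]; apply/colour_symP=> x.
  have [gc gf] := colour_symP _ _ gP (f x).
  rewrite permM gc SymA //; split=> //.
  rewrite inE negb_or => /andP[xk xks].
  by rewrite (SymP f fA x xk) in gf *; apply: gf.
apply/subsetP=> f /colour_symP fP.
have fA : f \in 'N(A | 'P).
  by apply/astabsP=> x; rewrite !inE /= /aperm (fP x).1.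
have rA : restr_perm A f \in Sym A by rewrite inE restr_perm_on.
have rE x : x \in A -> restr_perm A f x = f x by apply: restr_permE.
apply/mulsgP; exists (restr_perm A f) ((restr_perm A f)^-1 * f) => //.
  apply/colour_symP=> x; rewrite permM.
  have rV : (restr_perm A f)^-1 \in Sym A by rewrite groupV.
  rewrite (fP _).1 SymA //; split=> // xks.
  have [xk | nxk] := eqVneq (c x) k; last first.
    by rewrite (SymP _ rV x nxk) (fP x).2 // inE negb_or nxk.
  by rewrite -rE ?permKV // inE SymA // xk.
by rewrite mulKVg.
Qed.

Lemma colour_sym0 : colour_sym [::] = 1.
Proof.
apply/trivgP; apply/subsetP=> f /colour_symP fP; rewrite inE.
by apply/eqP/permP=> x; rewrite perm1 (fP x).2.
Qed.

Lemma colour_sym_isog k ks : uniq (k :: ks) ->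
  colour_sym (k :: ks) \isog
    [set: sym_prod #|colour_class k| [seq #|colour_class l| | l <- ks]].
Proof.
elim: ks k => [|l ks IHks] k /andP[nk uks].
  by rewrite -colour_sym_cons // colour_sym0 dprodg1 Sym_isog.
have dG := colour_sym_cons nk; rewrite dprodC in dG.
by have := isog_setX dG (IHks l uks) (Sym_isog _); rewrite setXTT.
Qed.
End ColourPerm.

(** * Colour refinement *)

HB.instance Definition _ :=
  Monoid.isComLaw.Build N N0 N.add N.add_assoc N.add_comm N.add_0_l.

Fixpoint add_at (i : nat) (v : N) (s : seq N) : seq N :=
  match s, i with
  | [::], _ => [::]
  | u :: s', 0 => N.add v u :: s'
  | u :: s', i'.+1 => u :: add_at i' v s'
  end.

Definition tally n (vs : seq (nat * N)) : seq N :=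
  foldr (fun iv => add_at iv.1 iv.2) (nseq n N0) vs.

Lemma size_add_at i v s : size (add_at i v s) = size s.
Proof. by elim: s i => [|u s IHs] [|i] //=; rewrite IHs. Qed.

Lemma nth_add_at i v s j : i < size s ->
  nth N0 (add_at i v s) j = if i == j then N.add v (nth N0 s j) else nth N0 s j.
Proof. by elim: s i j => [|u s IHs] [|i] [|j] //= lti; apply: IHs. Qed.

Lemma size_tally n vs : size (tally n vs) = n.
Proof. by elim: vs => [|iv vs IHvs] /=; rewrite ?size_nseq ?size_add_at. Qed.

Lemma nth_tally n vs j : all (fun iv => iv.1 < n) vs ->
  nth N0 (tally n vs) j = \big[N.add/N0]_(iv <- vs | iv.1 == j) iv.2.
Proof.
elim: vs => [|[i v] vs IHvs] /=; first by rewrite big_nil nth_nseq if_same.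
case/andP=> lti /IHvs IH; rewrite nth_add_at ?size_tally // IH big_cons /=.
by case: eqP.
Qed.

Definition entry (T : seq (seq nat)) x y := nth 0 (nth [::] T x) y.

(** The weight of a triple (x, y, xy) with colours a, b, c, where [sq] tells
whether x = y and [abs] whether x = xy. Any function of these data would give
an invariant; the coefficients of this one have no meaning beyond the fact that
enough rounds of refinement with it separate the orbits in all the semigroups
considered. *)
Definition weight (a b c : N) (sq abs : bool) : N :=
  let t := N.add (N.mul 3%num a) (N.add (N.mul 2%num b)
             (N.add c (N.add (if sq then 4%num else N0)
                             (if abs then 3%num else 1%num)))) in
  N.mul t t.

Definition contributions (T : seq (seq nat)) (c : seq N) : seq (nat * N) :=
  let c_ i := nth N0 c i in
  flatten [seq let z := entry T x y in
               let v := weight (c_ x) (c_ y) (c_ z) (x == y) (x == z) in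
               [:: (x, v); (y, v); (z, v)]
          | x <- iota 0 (size T), y <- iota 0 (size T)].

(** The scores are renamed to the position of their first occurrence, to keep
the numbers small in the next round. *)
Definition refine (T : seq (seq nat)) (c : seq N) : seq N :=
  let s := tally (size T) (contributions T c) in
  [seq N.of_nat (index v s) | v <- s].

(** A semigroup S with multiplication table T through the numbering phi of its
elements. *)
Section Tabulated.
Variables (S : finSemigroup) (T : seq (seq nat)) (phi : S -> nat).
Hypothesis phi_perm : perm_eq [seq phi x | x <- enum S] (iota 0 (size T)).
Hypothesis phiM : forall x y, phi (sg_mul x y) = entry T (phi x) (phi y).
Local Notation n := (size T).
Local Notation "x ** y" := (sg_mul x y) (at level 40, left associativity).
Implicit Types (c : seq N) (f : {perm S}) (x y : S).

Lemma phi_inj : injective phi.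
Proof.
by apply/injectiveP; rewrite /injectiveb /dinjectiveb (perm_uniq phi_perm) iota_uniq.
Qed.

Lemma phi_lt x : phi x < n.
Proof.
have := perm_mem phi_perm (phi x).
by rewrite (map_f _ (mem_enum _ x)) mem_iota.
Qed.

Lemma phi_surj i : i < n -> exists x, phi x = i.
Proof.
move=> lti; have := perm_mem phi_perm i.
by rewrite mem_iota /= add0n lti => /mapP[x _ ->]; exists x.
Qed.

Lemma entry_lt i j : i < n -> j < n -> entry T i j < n.
Proof. by move=> /phi_surj[x <-] /phi_surj[y <-]; rewrite -phiM phi_lt. Qed.

Lemma big_phi (F : nat -> N) :
  \big[N.add/N0]_(i <- iota 0 n) F i = \big[N.add/N0]_x F (phi x).
Proof. by rewrite -(perm_big _ phi_perm) big_map big_enum. Qed.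

Definition colour c x : N := nth N0 c (phi x).

Definition triple_weight c x y : N :=
  weight (colour c x) (colour c y) (colour c (x ** y)) (x == y) (x == x ** y).

Definition share c z x y : N :=
  let v := triple_weight c x y in
  N.add (if x == z then v else N0)
    (N.add (if y == z then v else N0) (if x ** y == z then v else N0)).

Lemma nth_tally_contributions c z :
  nth N0 (tally n (contributions T c)) (phi z)
    = \big[N.add/N0]_x \big[N.add/N0]_y share c z x y.
Proof.
rewrite nth_tally; last first.
  apply/allP=> iv /flattenP[_ /allpairsP[[i j] [+ + ->]]].
  rewrite !mem_iota /= !add0n => lti ltj.
  by rewrite !inE => /or3P[] /eqP->; rewrite //= entry_lt.
rewrite big_mkcond big_flatten big_allpairs_dep big_phi; apply: eq_bigr => x _.
rewrite big_phi; apply: eq_bigr => y _.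
rewrite !big_cons big_nil /= -!phiM !(inj_eq phi_inj).
by rewrite -/(triple_weight c x y) [N.add _ N0]N.add_0_r.
Qed.

Definition preserves f c := forall x, colour c (f x) = colour c x.

Lemma autM f x y : f \in semigroupAut S -> f (x ** y) = f x ** f y.
Proof. by rewrite inE => /forallP/(_ x)/forallP/(_ y)/eqP. Qed.

(** An automorphism permutes the triples (y, z, yz), preserving their weights
and moving the occurrences of x to occurrences of f x. *)
Lemma refine_preserves f c :
  f \in semigroupAut S -> preserves f c -> preserves f (refine T c).
Proof.
move=> fA fc x; rewrite /colour /refine !(nth_map N0) ?size_tally ?phi_lt //.
congr (N.of_nat (index _ _)).
rewrite !nth_tally_contributions (reindex_inj (@perm_inj _ f)); apply: eq_bigr => y _.
rewrite (reindex_inj (@perm_inj _ f)); apply: eq_bigr => z _.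
by rewrite /share /triple_weight -!(autM _ _ fA) !fc !(inj_eq perm_inj).
Qed.

Lemma size_refine c : size (refine T c) = n.
Proof. by rewrite size_map size_tally. Qed.

Lemma iter_refine_preserves f c k :
  f \in semigroupAut S -> preserves f c -> preserves f (iter k (refine T) c).
Proof. by move=> fA fc; elim: k => //= k; apply: refine_preserves. Qed.

Lemma size_iter_refine c k : size c = n -> size (iter k (refine T) c) = n.
Proof. by case: k => //= k _; rewrite size_refine. Qed.

Lemma colour_perm c : size c = n -> perm_eq [seq colour c x | x <- enum S] c.
Proof.
move=> sz_c; have := perm_map (nth N0 c) phi_perm.
by rewrite -map_comp -sz_c -/(mkseq _ _) mkseq_nth.
Qed.

Lemma card_colour_class c k : size c = n ->
  #|[set x | colour c x == k]| = count_mem k c.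
Proof.
move=> sz_c; rewrite -(seq.permP (colour_perm sz_c)) count_map enumT.
by rewrite cardsE cardE /enum_mem size_filter; apply: eq_count.
Qed.

Definition trivial_colouring : seq N := nseq n N0.

Lemma preserves_trivial f : preserves f trivial_colouring.
Proof. by move=> x; rewrite /colour !nth_nseq !if_same. Qed.

(** Each point of the base b gets a colour of its own, and all other points
share one. *)
Definition individualised (b : seq nat) : seq N :=
  [seq N.of_nat (index i b) | i <- iota 0 n].

Lemma preserves_individualised f (b : seq S) : {in b, forall x, f x = x} ->
  preserves f (individualised [seq phi x | x <- b]).
Proof.
move=> fb x; rewrite /colour !(nth_map 0) ?size_iota ?phi_lt // !nth_iota ?phi_lt //.
rewrite !add0n !(index_map phi_inj); congr N.of_nat.
have [xb | nxb] := boolP (x \in b); first by rewrite fb.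
have nfb : f x \notin b by apply: contra nxb => fxb; rewrite -(perm_inj (fb _ fxb)).
by rewrite !memNindex.
Qed.

(** * Automorphism groups from colourings *)

(** Points of the same colour have equal rows and equal columns (each is compared
with the first point of its colour), and every product is alone in its colour
class. *)
Definition twin_colouring c : bool :=
  let alone := [seq count_mem k c == 1 | k <- c] in
  all (fun i => let r := index (nth N0 c i) c in
         (nth [::] T i == nth [::] T r)
           && all (fun row => nth 0 row i == nth 0 row r) T) (iota 0 n)
  && all (all (nth false alone)) T.

(* Sorted by decreasing size of the class, in accordance with [sym_prod]. *)
Definition repeated c : seq N :=
  sort (fun k l => count_mem l c <= count_mem k c)
    [seq k <- undup c | 1 < count_mem k c].

Hypothesis T_square : all (fun row => size row == n) T.

Lemma alone_eq c x y : size c = n -> colour c x = colour c y ->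
  count_mem (colour c x) c <= 1 -> x = y.
Proof.
move=> sz_c cxy; rewrite -card_colour_class // => /card_le1_eqP; apply.
  by rewrite inE cxy.
by rewrite inE.
Qed.

(** Replacing factors by twins does not change a product, and f fixes products
because they are alone in their classes: f(xy) = xy = f(x)f(y). *)
Lemma twins_aut c f : size c = n -> twin_colouring c -> preserves f c ->
  f \in semigroupAut S.
Proof.
move=> sz_c /andP[/allP rowsP /allP aloneP] fc.
have in_iota x : phi x \in iota 0 n by rewrite mem_iota add0n phi_lt.
have repl x y z : colour c x = colour c y -> x ** z = y ** z /\ z ** x = z ** y.
  move=> cxy; have /andP[/eqP rowx /allP colx] := rowsP _ (in_iota x).
  have /andP[/eqP rowy /allP coly] := rowsP _ (in_iota y).
  have Tz : nth [::] T (phi z) \in T by rewrite mem_nth ?phi_lt.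
  move: rowx rowy (eqP (colx _ Tz)) (eqP (coly _ Tz)).
  rewrite -/(colour c x) -/(colour c y) cxy => rowx rowy colxz colyz.
  split; apply: phi_inj; rewrite !phiM /entry; first by rewrite rowx rowy.
  by rewrite colxz colyz.
have fixP x y : f (x ** y) = x ** y.
  apply: (alone_eq sz_c (fc _)); rewrite fc.
  have Tx : nth [::] T (phi x) \in T by rewrite mem_nth ?phi_lt.
  have := allP (aloneP _ Tx) (phi (x ** y)).
  rewrite phiM mem_nth; last by rewrite (eqP (allP T_square _ Tx)) phi_lt.
  move/(_ isT); rewrite -/(entry T _ _) -phiM (nth_map N0) ?sz_c ?phi_lt //.
  by move/eqP=> c1; rewrite /colour c1.
rewrite inE; apply/forallP=> x; apply/forallP=> y; rewrite fixP.
by rewrite (repl _ _ _ (fc x)).1 (repl _ _ _ (fc y)).2.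
Qed.

Lemma twins_isog k m ns :
    let c := iter k (refine T) trivial_colouring in
  twin_colouring c -> [seq count_mem l c | l <- repeated c] = m :: ns ->
  (semigroupAut S \isog [set: sym_prod m ns])%g.
Proof.
move=> c tw_c def_ns; set ks := repeated c in def_ns.
have sz_c : size c = n by rewrite size_iter_refine ?size_nseq.
have -> : semigroupAut S = colour_sym (colour c) ks.
  apply/setP=> f; apply/idP/colour_symP => [fA x | fP]; last first.
    by apply: twins_aut tw_c _ => // x; case: (fP x).
  have fc : preserves f c by apply: iter_refine_preserves (preserves_trivial f).
  split=> // nks; apply: (alone_eq sz_c (fc x)); rewrite fc leqNgt.
  apply: contra nks => gt1; rewrite mem_sort mem_filter gt1 mem_undup.
  by rewrite mem_nth ?sz_c ?phi_lt.
have : uniq ks by rewrite sort_uniq filter_uniq ?undup_uniq.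
have cardE l : #|colour_class (colour c) l| = count_mem l c.
  exact: card_colour_class.
case: ks def_ns => // l ks [<- <-] /(colour_sym_isog (colour c)).
by rewrite cardE (eq_map cardE).
Qed.

(** Induction on the base by the orbit-stabiliser theorem: the orbit of a point
is contained in its colour class. *)
Lemma rigid_card (G : {group {perm S}}) c (b : seq S) : size c = n ->
  {in G, forall f, preserves f c} ->
  {in G, forall f, {in b, forall x, f x = x} -> f = 1%g} ->
  #|G| <= \prod_(x <- b) count_mem (colour c x) c.
Proof.
move=> sz_c; elim: b G => [|x b IHb] G Gc rigid.
  rewrite big_nil -trivg_card_le1; apply/eqP/trivgP/subsetP=> f Gf.
  by rewrite inE; apply/eqP/rigid.
rewrite big_cons -(card_orbit_stab 'P G x) leq_mul //.
  rewrite -card_colour_class //; apply/subset_leq_card/subsetP=> _ /orbitP[f Gf <-].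
  by rewrite inE; apply/eqP; apply: Gc.
apply: IHb => [f /setIP[Gf _] | f /setIP[Gf /astab1P fx] fb]; first exact: Gc.
by apply: rigid => // y; rewrite inE => /predU1P[-> // | /fb].
Qed.

Lemma aut_card_le k l (b : seq nat) :
    let c := iter k (refine T) trivial_colouring in
    let d := iter l (refine T) (individualised b) in
  all (gtn n) b -> uniq d ->
  #|semigroupAut S| <= \prod_(i <- b) count_mem (nth N0 c i) c.
Proof.
move=> c d ltb ud.
have sz_c : size c = n by rewrite size_iter_refine ?size_nseq.
have sz_d : size d = n by rewrite size_iter_refine ?size_map ?size_iota.
have [b' def_b] : exists b' : seq S, b = map phi b'.
  elim: b ltb {d ud sz_d} => [|i b IHb] /=; first by exists [::].
  by case/andP=> /phi_surj[x <-] /IHb[b' ->]; exists (x :: b').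
subst b; rewrite big_map; apply: (@rigid_card [group of semigroupAut S] c) => // f fA.
  exact: iter_refine_preserves (preserves_trivial f).
move=> fb; apply/permP=> x; rewrite perm1.
have := iter_refine_preserves l fA (preserves_individualised fb) x.
move/eqP; rewrite nth_uniq ?phi_lt // -/d ?sz_d ?phi_lt //.
by move/eqP/phi_inj.
Qed.

Definition table_aut (p : seq nat) : bool :=
  [&& size p == n, uniq p, all (gtn n) p &
      all (fun i => all (fun j => nth 0 p (entry T i j) == entry T (nth 0 p i) (nth 0 p j))
        (iota 0 n)) (iota 0 n)].

Lemma table_autP p : table_aut p ->
  exists2 f, f \in semigroupAut S & forall x, phi (f x) = nth 0 p (phi x).
Proof.
case/and4P=> /eqP sz_p up /allP ltp /allP pM.
have /fin_all_exists[g gP] x : exists y, phi y = nth 0 p (phi x).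
  by apply: phi_surj; apply: ltp; rewrite mem_nth ?sz_p ?phi_lt.
have g_inj : injective g.
  move=> x y /(congr1 phi)/eqP; rewrite !gP nth_uniq ?sz_p ?phi_lt //.
  by move/eqP/phi_inj.
exists (perm g_inj) => [|x]; last by rewrite permE.
have in_iota x : phi x \in iota 0 n by rewrite mem_iota add0n phi_lt.
rewrite inE; apply/forallP=> x; apply/forallP=> y; rewrite !permE.
apply/eqP/phi_inj; rewrite phiM !gP phiM.
by apply/eqP/(allP (pM _ (in_iota x))).
Qed.
End Tabulated.

Lemma superext_table_square n' o :
  all (fun row => size row == size (superext_table n' o)) (superext_table n' o).
Proof. by apply/allP=> row /mapP[t _ ->]; rewrite !size_map. Qed.

(** * Certificates for superextensions *)

(** Each certificate below is a closed Boolean computation, in which the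
multiplication table is shared. The numbers k and l count rounds of
refinement. *)
Section Certificates.
Variables (n' : nat) (op : 'I_n'.+1 -> 'I_n'.+1 -> 'I_n'.+1).
Variables (opA : associative op) (o : nat -> nat -> nat).
Hypothesis opE : forall x y, op x y = o x y :> nat.
Local Notation S := (FinSemigroup opA).
Local Notation T := (superext_table n' o).
Local Notation phi := (@superext_index n' op opA).

Let phi_perm : perm_eq [seq phi F | F <- enum (superext S)] (iota 0 (size T)).
Proof. by rewrite size_map superext_index_perm. Qed.

Let phiM F G : phi (sg_mul F G) = entry T (phi F) (phi G).
Proof. exact: superext_tableE. Qed.

Definition twin_certificate k ns : bool :=
  let T := superext_table n' o in
  let c := iter k (refine T) (trivial_colouring T) in
  twin_colouring T c && ([seq count_mem l c | l <- repeated c] == ns).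

Lemma superext_twins k m ns : twin_certificate k (m :: ns) ->
  (semigroupAut (superext S) \isog [set: sym_prod m ns])%g.
Proof.
case/andP=> tw /eqP def_ns.
exact: (twins_isog phi_perm phiM (superext_table_square _ _) tw def_ns).
Qed.

Definition card_certificate k l b N : bool :=
  let T := superext_table n' o in
  let c := iter k (refine T) (trivial_colouring T) in
  let d := iter l (refine T) (individualised T b) in
  [&& all (gtn (size T)) b, uniq d &
      foldr muln 1 [seq count_mem (nth N0 c i) c | i <- b] <= N].

Lemma superext_card_le k l b N : card_certificate k l b N ->
  #|semigroupAut (superext S)| <= N.
Proof.
case/and3P=> ltb ud; apply: leq_trans.
by rewrite foldrE big_map; apply: (aut_card_le phi_perm phiM k ltb ud).
Qed.

Lemma superext_aut p : table_aut T p ->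
  exists2 f, f \in semigroupAut (superext S)
           & forall F, phi (f F) = nth 0 p (phi F).
Proof. exact: table_autP phi_perm phiM p. Qed.

(** The iterates of p at x stay away from x for N - 1 steps, so that the
automorphism p has order at least N. *)
Definition cyclic_certificate k l b N x p : bool :=
  let T := superext_table n' o in
  [&& card_certificate k l b N, table_aut T p, x < size T &
      all (fun i => iter i (nth 0 p) x != x) (iota 1 N.-1)].

Lemma superext_cyclic k l b N x p : 0 < N -> cyclic_certificate k l b N x p ->
  (semigroupAut (superext S) \isog Zp N)%g.
Proof.
move=> N_gt0 /and4P[/superext_card_le leN /superext_aut[f fA fE] ltx /allP moved].
have phiX i F : phi ((f ^+ i)%g F) = iter i (nth 0 p) (phi F).
  by rewrite permX; elim: i => //= i <-; rewrite fE.
have [F def_x] := phi_surj phi_perm ltx.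
apply: isog_Zp leN fA _ => // i /andP[i_gt0 ltiN].
have : i \in iota 1 N.-1 by rewrite mem_iota i_gt0 add1n prednK.
by move/moved; apply: contraNneq => fi1; rewrite -def_x -phiX fi1 perm1.
Qed.

Definition involutive_table (p : seq nat) : bool :=
  (p != iota 0 (size p)) && ([seq nth 0 p i | i <- p] == iota 0 (size p)).

Definition Klein_certificate k l b p q : bool :=
  let T := superext_table n' o in
  [&& card_certificate k l b 4, table_aut T p, table_aut T q,
      involutive_table p, involutive_table q & p != q].

Lemma superext_Klein k l b p q : Klein_certificate k l b p q ->
  (semigroupAut (superext S) \isog setX (Zp 2) (Zp 2))%g.
Proof.
case/and5P=> /superext_card_le le4 autp autq invp /andP[invq neq_pq].
have [f fA fE] := superext_aut autp; have [g gA gE] := superext_aut autq.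
have table_inj s t (h h' : {perm superext S}) :
    size s = size T -> size t = size T ->
    (forall F, phi (h F) = nth 0 s (phi F)) ->
    (forall F, phi (h' F) = nth 0 t (phi F)) -> h = h' -> s = t.
  move=> sz_s sz_t hs ht eq_h; apply: (@eq_from_nth _ 0) => [|i].
    by rewrite sz_t.
  by rewrite sz_s => /(phi_surj phi_perm)[F <-]; rewrite -hs -ht eq_h.
have size_table r : table_aut T r -> size r = size T by case/andP=> /eqP.
have nth_iota_phi F : phi F = nth 0 (iota 0 (size T)) (phi F).
  by rewrite nth_iota ?add0n // (phi_lt phi_perm).
have order2 r (h : {perm superext S}) : table_aut T r -> involutive_table r ->
    (forall F, phi (h F) = nth 0 r (phi F)) -> #[h]%g = 2.
  rewrite /involutive_table => autr; rewrite (size_table r autr).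
  move=> /andP[r_neq1 /eqP r_inv] hr.
  apply: nt_prime_order => //.
    apply/permP=> F; apply: (phi_inj phi_perm); rewrite perm1 permM !hr.
    by rewrite [RHS]nth_iota_phi -r_inv (nth_map 0) // size_table // (phi_lt phi_perm).
  apply: contraNneq r_neq1 => h1; apply/eqP.
  apply: (table_inj _ _ h 1%g); rewrite ?size_iota ?size_table // => F.
  by rewrite perm1 -nth_iota_phi.
apply: (isog_Klein le4 fA gA (order2 p f _ _ _) (order2 q g _ _ _)) => //.
apply: contra neq_pq => /eqP fg; apply/eqP.
by apply: (table_inj _ _ f g); rewrite ?size_table.
Qed.

End Certificates.

(** * Monogenic semigroups *)

Definition mono_op r m i j := (mred r m (i.+1 + j.+1)).-1.

(** The carrier of the monogenic semigroup is an ordinal type whose index is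
not syntactically a successor; this replaces it by one that is. *)
Lemma monogenic_ord r m (P : finSemigroup -> Prop) :
  (forall (op : 'I_(r + m).+1 -> 'I_(r + m).+1 -> 'I_(r + m).+1)
          (opA : associative op),
     (forall x y, op x y = mono_op r.+1 m.+1 x y :> nat) ->
     P (FinSemigroup opA)) ->
  P (monogenic r.+1 m.+1).
Proof.
have size_eq : (r.+1 + m.+1).-1 = (r + m).+1 by rewrite addSn addnS.
move=> P_ord; rewrite -[monogenic _ _]/(FinSemigroup (@mono_mulA r m)).
have opE (x y : 'I_(r.+1 + m.+1).-1) :
  mono_mul x y = mono_op r.+1 m.+1 x y :> nat by [].
move: (@mono_mul r m) (@mono_mulA r m) opE.
by rewrite size_eq; apply: P_ord.
Qed.

Lemma monogenic_twins r m k n ns :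
  twin_certificate (r + m) (mono_op r.+1 m.+1) k (n :: ns) ->
  (semigroupAut (superext (monogenic r.+1 m.+1)) \isog [set: sym_prod n ns])%g.
Proof.
move=> cert; pattern (monogenic r.+1 m.+1); apply: monogenic_ord => op opA opE.
exact: (superext_twins opA opE cert).
Qed.

Lemma monogenic_cyclic r m k l b N x p : 0 < N ->
  cyclic_certificate (r + m) (mono_op r.+1 m.+1) k l b N x p ->
  (semigroupAut (superext (monogenic r.+1 m.+1)) \isog Zp N)%g.
Proof.
move=> N_gt0 cert; pattern (monogenic r.+1 m.+1).
apply: monogenic_ord => op opA opE; exact: (superext_cyclic opA opE N_gt0 cert).
Qed.

Lemma monogenic_Klein r m k l b p q :
  Klein_certificate (r + m) (mono_op r.+1 m.+1) k l b p q ->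
  (semigroupAut (superext (monogenic r.+1 m.+1)) \isog setX (Zp 2) (Zp 2))%g.
Proof.
move=> cert; pattern (monogenic r.+1 m.+1); apply: monogenic_ord => op opA opE.
exact: (superext_Klein opA opE cert).
Qed.

(** The permutation of the families over n + 1 points that is induced by the
permutation sigma of the points: a set belongs to the image of a family iff its
preimage under sigma belongs to the family. *)
Definition induced n (sigma : nat -> nat) : seq nat :=
  let E := families n in
  [seq index (tabulate n.+1 (fun s =>
     lookup t [seq nth false s (sigma i) | i <- iota 0 n.+1])) E | t <- E].

(* The map a^e |-> a^(qe) on indices of exponents. *)
Definition power_map r m q i := (mred r m (q * i.+1)).-1.

(** Number 0 in the enumeration of the families is the principal family of the
generator a of C_5. *)
Lemma aut_superext_C5 :
  (semigroupAut (superext (monogenic 1 5)) \isog Zp 4)%g.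
Proof.
apply: (@monogenic_cyclic 0 4 1 3 [:: 0] 4 0 (induced 4 (power_map 1 5 2)) isT).
by vm_compute.
Qed.

(** The base consists of the principal family of a and of a family generated by
the two-element subsets of a three-element set. The four families of the latter
kind have the numbers 2, 3, 6, 9; the second involution multiplies them by a^2
and fixes all other families. *)
Lemma aut_superext_C4 :
  (semigroupAut (superext (monogenic 1 4)) \isog setX (Zp 2) (Zp 2))%g.
Proof.
apply: (@monogenic_Klein 0 3 2 2 [:: 0; 2] (induced 3 (power_map 1 4 3))
  [:: 0; 1; 6; 9; 4; 5; 2; 7; 8; 3; 10; 11]).
by vm_compute.
Qed.

Section SymmetricCases.
Local Open Scope group_scope.

Lemma aut_superext_2_3 :
  semigroupAut (superext (monogenic 2 3)) \isog [set: 'S_3 * 'S_5].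
Proof. by apply: (@monogenic_twins 1 2 2 5 [:: 3]); vm_compute. Qed.

Lemma aut_superext_3_2 :
  semigroupAut (superext (monogenic 3 2)) \isog [set: 'S_3 * 'S_4].
Proof. by apply: (@monogenic_twins 2 1 2 4 [:: 3]); vm_compute. Qed.

Lemma aut_superext_4_1 :
  semigroupAut (superext (monogenic 4 1)) \isog [set: 'S_3 * 'S_4].
Proof. by apply: (@monogenic_twins 3 0 2 4 [:: 3]); vm_compute. Qed.

Lemma aut_superext_2_4 :
  semigroupAut (superext (monogenic 2 4)) \isog
    [set: 'S_3 * 'S_3 * 'S_3 * 'S_8 * 'S_8 * 'S_8 * 'S_17 * 'S_19].
Proof.
by apply: (@monogenic_twins 1 3 2 19 [:: 17; 8; 8; 8; 3; 3; 3]); vm_compute.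
Qed.

Lemma aut_superext_3_3 :
  semigroupAut (superext (monogenic 3 3)) \isog
    [set: 'S_4 * 'S_4 * 'S_4 * 'S_5 * 'S_9 * 'S_9 * 'S_14 * 'S_18].
Proof.
by apply: (@monogenic_twins 2 2 2 18 [:: 14; 9; 9; 5; 4; 4; 4]); vm_compute.
Qed.

Lemma aut_superext_4_2 :
  semigroupAut (superext (monogenic 4 2)) \isog
    [set: 'S_4 * 'S_4 * 'S_4 * 'S_5 * 'S_9 * 'S_9 * 'S_14 * 'S_18].
Proof.
by apply: (@monogenic_twins 3 1 2 18 [:: 14; 9; 9; 5; 4; 4; 4]); vm_compute.
Qed.

Lemma aut_superext_5_1 :
  semigroupAut (superext (monogenic 5 1)) \isog
    [set: 'S_4 * 'S_4 * 'S_4 * 'S_5 * 'S_9 * 'S_9 * 'S_14 * 'S_18].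
Proof.
by apply: (@monogenic_twins 4 0 3 18 [:: 14; 9; 9; 5; 4; 4; 4]); vm_compute.
Qed.

End SymmetricCases.

Theorem mainTheorem2 :
  (* cardinality 1 *)
  semigroupAut (superext (monogenic 1 1)) \isog Zp 1 /\
  (* cardinality 2 *)
  [/\ semigroupAut (superext (monogenic 1 2)) \isog Zp 1
    & semigroupAut (superext (monogenic 2 1)) \isog Zp 1] /\
  (* cardinality 3 *)
  [/\ semigroupAut (superext (monogenic 1 3)) \isog Zp 2,
      semigroupAut (superext (monogenic 2 2)) \isog Zp 2
    & semigroupAut (superext (monogenic 3 1)) \isog Zp 1] /\
  (* cardinality 4 *)
  [/\ semigroupAut (superext (monogenic 1 4)) \isog setX (Zp 2) (Zp 2),
      semigroupAut (superext (monogenic 2 3)) \isog [set: 'S_3 * 'S_5],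
      semigroupAut (superext (monogenic 3 2)) \isog [set: 'S_3 * 'S_4]
    & semigroupAut (superext (monogenic 4 1)) \isog [set: 'S_3 * 'S_4]] /\
  (* cardinality 5 *)
  [/\ semigroupAut (superext (monogenic 1 5)) \isog Zp 4,
      semigroupAut (superext (monogenic 2 4)) \isog
        [set: 'S_3 * 'S_3 * 'S_3 * 'S_8 * 'S_8 * 'S_8 * 'S_17 * 'S_19],
      semigroupAut (superext (monogenic 3 3)) \isog
        [set: 'S_4 * 'S_4 * 'S_4 * 'S_5 * 'S_9 * 'S_9 * 'S_14 * 'S_18],
      semigroupAut (superext (monogenic 4 2)) \isog
        [set: 'S_4 * 'S_4 * 'S_4 * 'S_5 * 'S_9 * 'S_9 * 'S_14 * 'S_18]
    & semigroupAut (superext (monogenic 5 1)) \isog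
        [set: 'S_4 * 'S_4 * 'S_4 * 'S_5 * 'S_9 * 'S_9 * 'S_14 * 'S_18]].
Proof.
(* For trivial groups the base is empty and p is the identity. *)
split; first by apply: (@monogenic_cyclic 0 0 2 2 [::] 1 0 (iota 0 1)); vm_compute.
split.
  by split; [apply: (@monogenic_cyclic 0 1 2 2 [::] 1 0 (iota 0 2))
           | apply: (@monogenic_cyclic 1 0 2 2 [::] 1 0 (iota 0 2))]; vm_compute.
split; first split.
- apply: (@monogenic_cyclic 0 2 2 2 [:: 0] 2 0 (induced 2 (power_map 1 3 2)) isT).
  by vm_compute.
(* Families 0 and 1 over M_{2,2} are twins and not products. *)
- by apply: (@monogenic_cyclic 1 1 2 2 [:: 0] 2 0 [:: 1; 0; 2; 3]); vm_compute.
- by apply: (@monogenic_cyclic 2 0 2 2 [::] 1 0 (iota 0 4)); vm_compute.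
split; split.
- exact: aut_superext_C4.
- exact: aut_superext_2_3.
- exact: aut_superext_3_2.
- exact: aut_superext_4_1.
- exact: aut_superext_C5.
- exact: aut_superext_2_4.
- exact: aut_superext_3_3.
- exact: aut_superext_4_2.
exact: aut_superext_5_1.
Qed.
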